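(* Let $\Sigma$ be a digital time-delay system (satisfying (A.0), (A.1) of the context) and let $\varepsilon\in\mathbb R^+$ be any desired precision. Suppose that $\Sigma$ is $\delta$-IDSS, with functions $\beta,\gamma_U,\gamma_D$, and choose $\tau\in\mathbb R^+$ so that $\beta(\varepsilon,\tau)<\varepsilon$. Suppose moreover that there exist countable approximations $\mathcal A_X$ and $\mathcal A_D$ of $R_\tau(\Sigma)$ and $\mathcal D_\tau$, respectively. Then, for any $\lambda_X,\lambda_U,\lambda_D\in\mathbb R^+$ satisfying $$\max\{\beta(\varepsilon,\tau),\gamma_U(\lambda_U)+\gamma_D(\lambda_D)\}+\max\{\beta(\lambda_X,\tau),\gamma_D(\lambda_D)\}+\lambda_X\le\varepsilon,$$ the transition systems $T_{\tau,\lambda_X,\lambda_U,\lambda_D}(\Sigma)$ and $T_\tau(\Sigma)$ are alternating $\varepsilon$-approximately (A$\varepsilon$A) bisimilar.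
   Context: Notation: $\|\cdot\|$ is the infinity norm on $\mathbb R^n$; $\|\cdot\|_\infty$ the (essential) sup norm of functions; $\mathcal B_s(x)=\{y:\|y-x\|\le s\}$; $[A]_\theta=\{a\in A: a_i=k_i\theta,\ k_i\in\mathbb Z\}$ for $A\subseteq\mathbb R^n$. $\mathcal K$: continuous strictly increasing $\gamma:\mathbb R_0^+\to\mathbb R_0^+$ with $\gamma(0)=0$; $\mathcal{KL}$: continuous $\beta(r,s)$, class $\mathcal K$ in $r$, decreasing to $0$ in $s$. System: $\dot x(t)=f(x(t),x(t-\Delta(t)),u(t-r))$ for a.e. $t\ge0$, $x=\xi_0$ on $[-\Delta_{\max},0]$, $f:\mathbb R^n\times\mathbb R^n\times\mathbb R^m\to\mathbb R^n$, $r\ge0$, $\Delta_{\min},\Delta_{\max}\in\mathbb R_0^+$. The solution is $x(t,\xi_0,u,\Delta)$, and $x_t(\xi_0,u,\Delta)\in C^0([-\Delta_{\max},0];\mathbb R^n)$ is $x_t(\theta)=x(t+\theta)$. (A.0): $f(0,0,0)=0$, $f$ Lipschitz on bounded sets; $\mathcal U$ = measurable functions $[-r,\infty[\to U:=\mathcal B_{B_U}(0)\subset\mathbb R^m$, $B_U>0$; the initial condition $\xi_0$ is $C^1$ on $[-\Delta_{\max},0]$ with sup norm $\le B_X^0$ and derivative bounded by $M_1$ ($B_X^0>0,M_1\ge0$); the delay belongs to $\mathcal D$ = all $C^1$ functions $\Delta:\mathbb R_0^+\to[\Delta_{\min},\Delta_{\max}]$ with $|\dot\Delta|\le d_{\min}$,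 $d_{\min}\in[0,1[$. (A.1) (ISS): there are $\beta_{ISS}\in\mathcal{KL}$, $\gamma_{ISS}\in\mathcal K$ such that for all $\xi_0\in C^0([-\Delta_{\max},0];\mathbb R^n)$, $u\in\mathcal U$, $\Delta\in\mathcal D$ the solution exists for all $t\ge0$ and $\|x_t(\xi_0,u,\Delta)\|_\infty\le\max\{\beta_{ISS}(\|\xi_0\|_\infty,t),\gamma_{ISS}(\|u|_{[-r,t-r[}\|_\infty)\}$. Put $B_X=\max\{\beta_{ISS}(B_X^0,0),\gamma_{ISS}(B_U)\}$, $X=\mathcal B_{B_X}(0)$, $\mathcal X=C^0([-\Delta_{\max},0];X)$. $\delta$-IDSS with functions $\beta\in\mathcal{KL}$, $\gamma_U,\gamma_D\in\mathcal K$: for any $t\ge0$, any initial conditions $\xi_1,\xi_2$, any inputs $u_1,u_2$ and any time-delay functions $\Delta_1,\Delta_2$, the corresponding solutions exist for all $t\ge0$ and $$\|x_t(\xi_1,u_1,\Delta_1)-x_t(\xi_2,u_2,\Delta_2)\|_\infty\le\max\{\beta(\|\xi_1-\xi_2\|_\infty,t),\gamma_U(\|(u_1-u_2)|_{[-r,t-r[}\|_\infty)+\gamma_D(\|(\Delta_1-\Delta_2)|_{[0,t[}\|_\infty)\}.$$ Digital time-delay system (a time-delay system with a digital controller of sampling time $\tau$, the motivation being piecewise constant control inputs): the class of control inputs is $\mathcal U_\tau=\{u:[-r,-r+\tau]\to U\mid\exists v\in\mathcal U:\ u=v|_{[-r,-r+\tau]}\}$; also $\mathcal D_\tau=\{\Delta:[0,\tau]\to[\Delta_{\min},\Delta_{\max}]\mid\exists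 d\in\mathcal D:\ \Delta=d|_{[0,\tau]}\}$. For $k\in\mathbb N$, $\mathcal U_{k,\tau}$ and $\mathcal D_{k,\tau}$ are the classes of signals obtained by concatenation of $k$ elements of $\mathcal U_\tau$, resp. $\mathcal D_\tau$. $R_\tau(\Sigma)\subseteq\mathcal X$ is the set of reachable states at times $0,\tau,\dots,k\tau,\dots$: all $x\in\mathcal X$ for which there exist $k\in\mathbb N$, $u\in\mathcal U_{k,\tau}$, $\Delta\in\mathcal D_{k,\tau}$ with $x=x_{k\tau}(\xi_0,u,\Delta)$. Countable approximation of $\mathcal Y\subseteq C^0(I,Y)$ ($Y\subseteq\mathbb R^n$, $I$ a compact interval): a map $\mathcal A:\mathbb R^+\to2^{C^0(I,Y)}$ such that for every $\lambda>0$: $\mathcal A(\lambda)$ is countable; $\forall y\in\mathcal Y\ \exists z\in\mathcal A(\lambda)$ with $\|y-z\|_\infty\le\lambda$; $\forall z\in\mathcal A(\lambda)\ \exists y\in\mathcal Y$ with $\|y-z\|_\infty\le\lambda$. For $R_\tau(\Sigma)$: $I=[-\Delta_{\max},0]$, $Y=X$; for $\mathcal D_\tau$: $I=[0,\tau]$, $Y=[\Delta_{\min},\Delta_{\max}]$. The set $\mathcal A_U(\lambda_U)=\{u\in\mathcal U_\tau:\ u(t)=u(-r)\in[U]_{2\lambda_U},\ t\in[-r,-r+\tau]\}$ is taken as countable approximation of $\mathcal U_\tau$. Transition systems: $T=(Q,q^0,A\times B,\to,O,H)$ with states $Q$, initial state $q^0\in Q$, control labels $A$, disturbance labels $B$,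 transition relation $\to\subseteq Q\times(A\times B)\times Q$, output set $O$ with metric $\mathbf d$, output map $H:Q\to O$. $T_\tau(\Sigma)$: $Q_1=\mathcal X$, $q_1^0=\xi_0$, $A_1$ = the $a_1\in\mathcal U_\tau$ such that $x_\tau(x,a_1,b_1)$ is defined for any $x\in\mathcal X$ and $b_1\in B_1$, $B_1$ = the $b_1\in\mathcal D_\tau$ such that $x_\tau(x,a_1,b_1)$ is defined for any $x\in\mathcal X$ and $a_1\in A_1$; $q\to_1^{a,b}p$ if $x_\tau(q,a,b)=p$; $O_1=\mathcal X$ with $\mathbf d(p,q)=\|p-q\|_\infty$; $H_1$ = identity. $T_{\tau,\lambda_X,\lambda_U,\lambda_D}(\Sigma)$: $Q_2=\mathcal A_X(\lambda_X)$, $q_2^0\in Q_2$ such that $\|\xi_0-q_2^0\|_\infty\le\lambda_X$, $A_2=\mathcal A_U(\lambda_U)$, $B_2=\mathcal A_D(\lambda_D)$, $q\to_2^{a,b}p$ if $\|p-x_\tau(q,a,b)\|_\infty\le\max\{\beta(\lambda_X,\tau),\gamma_D(\lambda_D)\}+\lambda_X$, $O_2=\mathcal X$ with the same metric, $H_2$ = inclusion. A$\varepsilon$A simulation relation from $T_1$ to $T_2$ (same output set and metric): $R\subseteq Q_1\times Q_2$ such that for every $(q_1,q_2)\in R$: (i) $\mathbf d(H_1(q_1),H_2(q_2))\le\varepsilon$; (ii) $\forall a_1\in A_1\ \exists a_2\in A_2\ \forall b_2\in B_2\ \exists b_1\in B_1$ such that $q_1\to_1^{a_1,b_1}p_1$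 and $q_2\to_2^{a_2,b_2}p_2$ with $(p_1,p_2)\in R$. $T_1,T_2$ are A$\varepsilon$A bisimilar if some $R$ with $(q_1^0,q_2^0)\in R$ is an A$\varepsilon$A simulation relation from $T_1$ to $T_2$ and $R^{-1}$ is one from $T_2$ to $T_1$.
   Formalization: Made explicit: all states reachable at multiples of τ under concatenated inputs and delays lie in the state space (not implied by (A.1), as concatenated delays may jump); δ-IDSS holds for a class of continuous delays that contains the class D and extensions of the elements of A_D(λ_D). *)

(* Defs.v *)
From HB Require Import structures.
From mathcomp Require Export all_boot all_order all_algebra.
From mathcomp Require Export all_classical all_reals all_analysis.
From mathcomp Require Export ess_sup_inf.

Set Implicit Arguments.
Unset Strict Implicit.
Unset Printing Implicit Defensive.

Import Order.TTheory GRing.Theory Num.Theory numFieldNormedType.Exports.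

#[global] Open Scope classical_set_scope.
#[global] Open Scope ring_scope.

(* A function on a subset W of the line is represented by a total function
   R -> V; g \_ W (equal to g on W and to [point] elsewhere) is the restriction
   of g to W.  Wherever sets of functions are counted, compared by equality or
   used as states and labels, their elements are restricted in this sense, so
   that two elements that agree on W are equal. *)

Section functions.
Variable R : realType.

Definition sup_norm (V : normedModType R) (W : set R) (g : R -> V) : R :=
  sup [set `|g t| | t in W].

(* The indicator makes the norm over a negligible W equal to 0. *)
Definition ess_norm (V : normedModType R) (W : set R) (g : R -> V) : R :=
  fine (ess_sup (@lebesgue_measure R) (fun t => (`|g t| * \1_W t)%:E)).

Definition C0 (V : normedModType R) (W : set R) (Y : set V) : set (R -> V) :=
  [set g | [/\ g \_ W = g, {within W, continuous g} & forall t, W t -> Y (g t)]].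

(* For an interval W: g is C^1 on W, one-sidedly at the endpoints in W, and
   its derivative is bounded by M. *)
Definition C1_bounded (V : normedModType R) (W : set R) (M : R) (g : R -> V) :=
  {within W, continuous g} /\
  exists g' : R -> V,
    [/\ {within W, continuous g'},
        forall t, W° t -> is_derive t 1 g (g' t)
      & forall t, W t -> `|g' t| <= M].

Definition abs_continuous (V : normedModType R) (a b : R) (g : R -> V) :=
  forall e, 0 < e -> exists2 d, 0 < d &
    forall (k : nat) (s t : nat -> R),
      (forall i, (i < k)%N -> [&& a <= s i, s i <= t i & t i <= b]) ->
      (forall i j, (i < j < k)%N -> t i <= s j) ->
      \sum_(i < k) (t i - s i) < d ->
      \sum_(i < k) `|g (t i) - g (s i)| < e.

Definition class_K (gamma : R -> R) :=
  [/\ {within [set x | 0 <= x], continuous gamma},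
      forall x y, 0 <= x -> x < y -> gamma x < gamma y
    & gamma 0 = 0].

Definition class_KL (beta : R -> R -> R) :=
  [/\ {within [set p : R * R | 0 <= p.1 /\ 0 <= p.2],
         continuous (fun p : R * R => beta p.1 p.2)},
      forall s, 0 <= s -> class_K (beta^~ s),
      forall x s t, 0 <= x -> 0 <= s -> s <= t -> beta x t <= beta x s
    & forall x, 0 <= x -> beta x s @[s --> +oo] --> 0].

Definition restrictions (V : normedModType R) (W : set R) (S : set (R -> V)) :
    set (R -> V) :=
  [set g | exists2 h, S h & g = h \_ W].

(* Signals starting at time a, obtained by concatenating k signals that are
   given on [a, a + tau]; junction points are attributed to the next signal. *)
Definition concatenations (V : normedModType R) (a tau : R) (k : nat)
    (S : set (R -> V)) : set (R -> V) :=
  [set g | exists w : nat -> R -> V, forall i, (i < k)%N -> S (w i) /\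
     forall t, a <= t < a + tau -> g (t + i%:R * tau) = w i t].

Definition approximates (V : normedModType R) (norm : (R -> V) -> R)
    (lambda : R) (Y S : set (R -> V)) :=
  [/\ countable S,
      forall y, Y y -> exists2 z, S z & norm (y \- z) <= lambda
    & forall z, S z -> exists2 y, Y y & norm (y \- z) <= lambda].

Definition countable_approximation (V : normedModType R) (W : set R)
    (Y : set V) (YY : set (R -> V)) (A : R -> set (R -> V)) :=
  forall lambda, 0 < lambda ->
    A lambda `<=` C0 W Y /\ approximates (sup_norm W) lambda YY (A lambda).

Definition grid (m : nat) (A : set 'rV[R]_m) (theta : R) : set 'rV[R]_m :=
  [set a | A a /\ forall i, exists k : int, a 0 i = k%:~R * theta].

End functions.

Section transition_systems.
Variables (R : realType) (O : Type).

Record transition_system (Q A B : Type) := TransitionSystem {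
  states : set Q;
  initial : Q;
  controls : set A;
  disturbances : set B;
  transition : Q -> A -> B -> Q -> Prop;
  outputs : set O;
  metric : O -> O -> R;
  output : Q -> O }.

Definition AeA_simulation (Q1 A1 B1 Q2 A2 B2 : Type) (eps : R)
    (T1 : transition_system Q1 A1 B1) (T2 : transition_system Q2 A2 B2)
    (Rel : Q1 -> Q2 -> Prop) :=
  [/\ outputs T1 = outputs T2, metric T1 = metric T2,
      forall q1 q2, Rel q1 q2 -> states T1 q1 /\ states T2 q2
    & forall q1 q2, Rel q1 q2 ->
      metric T1 (output T1 q1) (output T2 q2) <= eps /\
      forall a1, controls T1 a1 -> exists2 a2, controls T2 a2 &
      forall b2, disturbances T2 b2 -> exists2 b1, disturbances T1 b1 &
      exists p1 p2, [/\ transition T1 q1 a1 b1 p1,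
                        transition T2 q2 a2 b2 p2 & Rel p1 p2]].

Definition AeA_bisimilar (Q1 A1 B1 Q2 A2 B2 : Type) (eps : R)
    (T1 : transition_system Q1 A1 B1) (T2 : transition_system Q2 A2 B2) :=
  exists Rel : Q1 -> Q2 -> Prop,
    [/\ Rel (initial T1) (initial T2),
        AeA_simulation eps T1 T2 Rel
      & AeA_simulation eps T2 T1 (fun q2 q1 => Rel q1 q2)].

End transition_systems.

(* |.| on row vectors is the infinity norm. *)
Record tds (R : realType) (n m : nat) := TDS {
  rhs : 'rV[R]_n * 'rV[R]_n * 'rV[R]_m -> 'rV[R]_n;
  lag : R;  (* input delay r *)
  Dmin : R;
  Dmax : R;
  dmin : R;
  BU : R;
  BX0 : R;
  M1 : R;
  xi0 : R -> 'rV[R]_n }.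

Section time_delay_systems.
Variables (R : realType) (n m : nat) (S : tds R n m).

Local Notation hist_itv := `[- Dmax S, 0]%classic.

Definition input_values : set 'rV[R]_m := [set w | `|w| <= BU S].

Definition inputs : set (R -> 'rV[R]_m) :=
  [set u : R -> 'rV[R]_m |
    (forall j, measurable_fun `[- lag S, +oo[%classic (fun t : R => u t 0 j)) /\
    forall t, - lag S <= t -> input_values (u t)].

Definition delay_values : set R := [set d | Dmin S <= d <= Dmax S].

Definition delays : set (R -> R) :=
  [set D : R -> R | (forall t, 0 <= t -> delay_values (D t)) /\
           C1_bounded `[0, +oo[%classic (dmin S) D].

(* Any continuous time-delay function; such a function need not be in [delays]. *)
Definition delay_signals : set (R -> R) :=
  [set D : R -> R | (forall t, 0 <= t -> delay_values (D t)) /\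
           {within `[0, +oo[%classic, continuous D}].

Definition A0 :=
  [/\ rhs S (0, 0, 0) = 0,
      forall A, bounded_set A -> [lipschitz rhs S z | z in A],
      [/\ 0 <= lag S, 0 <= Dmin S, 0 <= Dmax S & 0 <= dmin S < 1],
      [/\ 0 < BU S, 0 < BX0 S & 0 <= M1 S]
    & [/\ C0 hist_itv setT (xi0 S), sup_norm hist_itv (xi0 S) <= BX0 S
        & C1_bounded hist_itv (M1 S) (xi0 S)]].

(* Caratheodory solution on [0, T]. *)
Definition solution_on (T : R) (xi : R -> 'rV[R]_n) (u : R -> 'rV[R]_m)
    (D : R -> R) (x : R -> 'rV[R]_n) :=
  [/\ forall t, - Dmax S <= t <= 0 -> x t = xi t,
      abs_continuous 0 T x
    & {ae (@lebesgue_measure R), forall t : R, 0 <= t <= T ->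
        is_derive t 1 x (rhs S (x t, x (t - D t), u (t - lag S)))}].

Definition solution (xi : R -> 'rV[R]_n) (u : R -> 'rV[R]_m)
    (D : R -> R) (x : R -> 'rV[R]_n) :=
  forall T, 0 <= T -> solution_on T xi u D x.

(* The segment x_t of x. *)
Definition segment (x : R -> 'rV[R]_n) (t : R) : R -> 'rV[R]_n :=
  (fun theta => x (t + theta)) \_ hist_itv.

(* x_t(xi, u, D) is defined and equal to p. *)
Definition state_at (t : R) (xi : R -> 'rV[R]_n) (u : R -> 'rV[R]_m)
    (D : R -> R) (p : R -> 'rV[R]_n) :=
  exists2 x, solution_on t xi u D x & p = segment x t.

Definition ISS (beta : R -> R -> R) (gamma : R -> R) :=
  [/\ class_KL beta, class_K gamma
    & forall xi u D, C0 hist_itv setT xi -> inputs u -> delays D ->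
      (exists x, solution xi u D x) /\
      forall x, solution xi u D x -> forall t, 0 <= t ->
        sup_norm hist_itv (segment x t) <=
        Num.max (beta (sup_norm hist_itv xi) t)
                (gamma (ess_norm `[- lag S, t - lag S[%classic u))].

Definition BX (beta : R -> R -> R) (gamma : R -> R) : R :=
  Num.max (beta (BX0 S) 0) (gamma (BU S)).

Definition X_values (bX : R) : set 'rV[R]_n := [set x | `|x| <= bX].

Definition state_space (bX : R) : set (R -> 'rV[R]_n) :=
  C0 hist_itv (X_values bX).

(* XX and DD are the initial conditions and the time-delay functions to which the
   property refers.  They are parameters because the segments and delays it is
   applied to include elements of countable approximations, which are merely
   continuous and need not be C^1 as xi0 and [delays] are. *)
Definition delta_IDSS (XX : set (R -> 'rV[R]_n)) (DD : set (R -> R))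
    (beta : R -> R -> R) (gammaU gammaD : R -> R) :=
  [/\ class_KL beta, class_K gammaU, class_K gammaD,
      forall xi u D, XX xi -> inputs u -> DD D -> exists x, solution xi u D x
    & forall xi1 xi2 u1 u2 D1 D2 x1 x2,
      XX xi1 -> XX xi2 -> inputs u1 -> inputs u2 -> DD D1 -> DD D2 ->
      solution xi1 u1 D1 x1 -> solution xi2 u2 D2 x2 ->
      forall t, 0 <= t ->
        sup_norm hist_itv (segment x1 t \- segment x2 t) <=
        Num.max (beta (sup_norm hist_itv (xi1 \- xi2)) t)
          (gammaU (ess_norm `[- lag S, t - lag S[%classic (u1 \- u2)) +
           gammaD (sup_norm `[0, t[%classic (D1 \- D2)))].

Section digital.
(* UU is the class of the inputs that the digital controller can produce:
   all of [inputs], or a subclass such as the piecewise constant ones. *)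
Variables (UU : set (R -> 'rV[R]_m)) (tau bX : R).

Local Notation U_itv := `[- lag S, - lag S + tau]%classic.
Local Notation D_itv := `[0, tau]%classic.

Definition U_tau : set (R -> 'rV[R]_m) := restrictions U_itv UU.

Definition D_tau : set (R -> R) := restrictions D_itv delays.

(* A concatenation of elements of D_tau may jump at the multiples of tau, hence
   is in general not covered by [ISS], and a reachable segment is not a priori
   in state_space bX. *)
Definition reachable : set (R -> 'rV[R]_n) :=
  [set p | exists (k : nat) u D,
    [/\ concatenations (- lag S) tau k U_tau u,
        concatenations 0 tau k D_tau D
      & state_at (k%:R * tau) (xi0 S) u D p]].

Definition R_tau : set (R -> 'rV[R]_n) := state_space bX `&` reachable.

Definition A_U (lambda : R) : set (R -> 'rV[R]_m) :=
  [set u | U_tau u /\ forall t, U_itv t ->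
     u t = u (- lag S) /\ grid input_values (2 * lambda) (u (- lag S))].

(* The defining equations of the label sets A_1 and B_1 of T_tau, each of which
   refers to the other. *)
Definition T_tau_labels (A1 : set (R -> 'rV[R]_m)) (B1 : set (R -> R)) :=
  A1 = [set a | U_tau a /\ forall x b, state_space bX x -> B1 b ->
                  exists p, state_at tau x a b p] /\
  B1 = [set b | D_tau b /\ forall x a, state_space bX x -> A1 a ->
                  exists p, state_at tau x a b p].

Definition T_tau (A1 : set (R -> 'rV[R]_m)) (B1 : set (R -> R)) :=
  {| states := state_space bX;
     initial := xi0 S;
     controls := A1;
     disturbances := B1;
     transition := fun q a b p =>
       [/\ state_space bX q, A1 a, B1 b, state_space bX p
         & state_at tau q a b p];
     outputs := state_space bX;
     metric := fun p q => sup_norm hist_itv (p \- q);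
     output := id |}.

Definition T_approx (beta : R -> R -> R) (gammaD : R -> R)
    (AX : R -> set (R -> 'rV[R]_n)) (AD : R -> set (R -> R))
    (lambdaX lambdaU lambdaD : R) (q20 : R -> 'rV[R]_n) :=
  {| states := AX lambdaX;
     initial := q20;
     controls := A_U lambdaU;
     disturbances := AD lambdaD;
     transition := fun q a b p =>
       [/\ AX lambdaX q, A_U lambdaU a, AD lambdaD b, AX lambdaX p
         & exists2 z, state_at tau q a b z &
             sup_norm hist_itv (p \- z) <=
             Num.max (beta lambdaX tau) (gammaD lambdaD) + lambdaX];
     outputs := state_space bX;
     metric := fun p q => sup_norm hist_itv (p \- q);
     output := id |}.

End digital.

End time_delay_systems.

(* Main.v *)
Require Import Defs.
From mathcomp Require Import measurable_realfun lra ring.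
Import Order.TTheory GRing.Theory Num.Theory numFieldNormedType.Exports.

(* Relate q2 in A_X(lambda_X) to a reachable q1 when they are eps-close. Let
   p1 and z be the states reached from q1 under (a1, b1) and from q2 under
   (a2, b2), where the two controls are lambda_U-close and the two
   disturbances are lambda_D-close: delta-IDSS bounds |p1 - z| by the first
   maximum of the hypothesis on the parameters. As z need not be reachable,
   A_X need not approximate it; but q2 is lambda_X-close to a reachable y, and
   y reaches under (a2, b1) a state w, which is again reachable and which
   delta-IDSS puts within the second maximum of z. A point p2 of A_X that is
   lambda_X-close to w is a successor of q2, and the triangle inequality
   through z gives |p1 - p2| <= eps.

   Reachability is preserved because a solution can be continued by a solution
   starting from its last segment; the equation holds almost everywhere after
   the junction since Lebesgue measure is invariant under translation. *)

(** * Suprema and essential suprema of signals *)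

Section norms.
Context {R : realType} {V : normedModType R}.
Implicit Types (W : set R) (f g h : R -> V).

Lemma sup_norm_le W g c :
  W !=set0 -> (forall t, W t -> `|g t| <= c) -> sup_norm W g <= c.
Proof.
move=> [t0 Wt0] gc; apply: ge_sup; first by exists `|g t0|, t0.
by move=> _ [t Wt <-]; exact: gc.
Qed.

(** Some bound [M] must be known, since [sup] of an unbounded set takes the default value 0. *)
Lemma norm_le_sup_norm W g M t :
  (forall s, W s -> `|g s| <= M) -> W t -> `|g t| <= sup_norm W g.
Proof.
move=> gM Wt; apply: ub_le_sup; last by exists t.
by exists M => _ [s Ws <-]; exact: gM.
Qed.

Lemma norm_sub_le W f g Mf Mg :
  (forall t, W t -> `|f t| <= Mf) -> (forall t, W t -> `|g t| <= Mg) ->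
  forall t, W t -> `|(f \- g) t| <= Mf + Mg.
Proof.
move=> fM gM t Wt; apply: le_trans (ler_normB _ _) _.
by apply: lerD; [exact: fM|exact: gM].
Qed.

Lemma sup_norm_subC W f g : sup_norm W (f \- g) = sup_norm W (g \- f).
Proof.
rewrite /sup_norm; congr (sup (_ @` _)).
by apply/funext => t; rewrite /= distrC.
Qed.

Lemma sup_norm_trans W f g h Mf Mg Mh : W !=set0 ->
  (forall t, W t -> `|f t| <= Mf) -> (forall t, W t -> `|g t| <= Mg) ->
  (forall t, W t -> `|h t| <= Mh) ->
  sup_norm W (f \- h) <= sup_norm W (f \- g) + sup_norm W (g \- h).
Proof.
move=> W0 fM gM hM; apply: sup_norm_le => // t Wt.
have -> : (f \- h) t = (f \- g) t + (g \- h) t by rewrite /= addrA subrK.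
apply: le_trans (ler_normD _ _) (lerD _ _).
- exact: norm_le_sup_norm _ _ _ _ (norm_sub_le _ _ _ _ _ fM gM) Wt.
- exact: norm_le_sup_norm _ _ _ _ (norm_sub_le _ _ _ _ _ gM hM) Wt.
Qed.

Lemma sup_norm_ge0 W g : 0 <= sup_norm W g.
Proof.
rewrite /sup_norm.
have [Wsup|/sup_out ->//] := pselect (has_sup [set `|g t| | t in W]).
have [[_ [t Wt _]] gW] := Wsup.
by apply: le_trans (normr_ge0 (g t)) (ub_le_sup gW _); exists t.
Qed.

Lemma lebesgue_setT_gt0 : (0 < @lebesgue_measure R setT)%E.
Proof.
by rewrite -set_itvNyy lebesgue_measure_itv/= addye. Qed.

(** [fine] sends infinite values to 0, so these are excluded before essential norms are compared. *)
Lemma ess_sup_norm_fin_num W g M : (forall t, W t -> `|g t| <= M) ->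
  ess_sup (@lebesgue_measure R) (fun t => (`|g t| * \1_W t)%:E) \is a fin_num.
Proof.
move=> gM; apply/fin_numPlt/andP; split.
- apply: (@lt_le_trans _ _ 0%E); first exact: ltNy0.
  apply: ess_sup_ger => [|t]; first exact: lebesgue_setT_gt0.
  by rewrite lee_fin mulr_ge0.
- apply: (@le_lt_trans _ _ (Num.max M 0)%:E); last exact: ltry.
  apply: ess_sup_ler => t; rewrite lee_fin indicE le_max.
  have [/set_mem/gM|_] := boolP (t \in W); first by rewrite mulr1 => ->.
  by rewrite mulr0 lexx orbT.
Qed.

Lemma le_ess_norm W W' f g M : W `<=` W' -> {in W, f =1 g} ->
  (forall t, W' t -> `|g t| <= M) -> ess_norm W f <= ess_norm W' g.
Proof.
move=> WW' fg gM; apply: fine_le.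
- apply: (@ess_sup_norm_fin_num _ _ M) => t Wt.
  by rewrite fg ?inE//; apply: gM; exact: WW'.
- exact: ess_sup_norm_fin_num gM.
apply: le_ess_sup; apply: nearW => t; rewrite lee_fin !indicE.
have [tW|tW] := boolP (t \in W); last by rewrite mulr0 mulr_ge0.
rewrite fg//; have -> // : t \in W' by rewrite inE; apply: WW'; exact/set_mem.
Qed.

Lemma ess_norm_ge0 W g : 0 <= ess_norm W g.
Proof.
apply/fine_ge0/ess_sup_ger => [|t]; first exact: lebesgue_setT_gt0.
by rewrite lee_fin mulr_ge0.
Qed.

Lemma ess_norm_subrr W f : ess_norm W (f \- f) = 0.
Proof.
rewrite /ess_norm; under eq_fun do rewrite /= subrr normr0 mul0r.
by rewrite ess_sup_cst//; exact: lebesgue_setT_gt0.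
Qed.

End norms.

(** * Comparison functions *)

Lemma le_class_K {R : realType} (gamma : R -> R) x y :
  class_K gamma -> 0 <= x -> x <= y -> gamma x <= gamma y.
Proof.
move=> [_ gammaI _] x0; rewrite le_eqVlt => /predU1P[->//|xy].
exact/ltW/gammaI.
Qed.

Lemma class_K_ge0 {R : realType} (gamma : R -> R) x :
  class_K gamma -> 0 <= x -> 0 <= gamma x.
Proof.
by move=> Kg x0; have [_ _ g0] := Kg; rewrite -{1}g0; exact: le_class_K.
Qed.

(** * Translation in time *)

(** The push-forward of Lebesgue measure under the shift agrees with it on half-open intervals, and
    these determine it. *)
Lemma lebesgue_measure_shift {R : realType} (c : R) (A : set R) :
  measurable A -> lebesgue_measure (shift c @^-1` A) = lebesgue_measure A.
Proof.
move=> mA.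
have mc : measurable_fun setT
    (shift c : measurableTypeR R -> measurableTypeR R).
  exact: measurable_funD.
pose nu : {measure set (measurableTypeR R) -> \bar R} :=
  @pushforward _ _ _ (measurableTypeR R) R (@lebesgue_measure R) (shift c).
apply/esym; rewrite (@lebesgue_measure_unique R (nu mc) _ A mA)//.
move=> _ [[a b] /= _ <-]; rewrite /nu/= /pushforward/=.
have -> : shift c @^-1` `]a, b] = `]a - c, b - c]%classic.
  by apply/seteqP; split=> t /=; rewrite !in_itv/= ltrBlDr lerBrDr.
rewrite !lebesgue_measure_itv/= !lte_fin ltrD2r.
by case: ifP => // _; rewrite -!EFinB; congr EFin; ring.
Qed.

Lemma ae_translate {R : realType} (c : R) (P : R -> Prop) :
  (\forall t \ae @lebesgue_measure R, P t) ->
  \forall t \ae @lebesgue_measure R, P (t - c).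
Proof.
move=> [N [mN N0 PN]].
have mc : measurable_fun setT
    (shift (- c) : measurableTypeR R -> measurableTypeR R).
  exact: measurable_funD.
exists (shift (- c) @^-1` N); split.
- by rewrite -[X in measurable X]setTI; exact: mc.
- by rewrite -[RHS]N0; exact: lebesgue_measure_shift.
- by move=> t; exact: PN.
Qed.

Lemma ae_neq {R : realType} (c : R) : \forall t \ae @lebesgue_measure R, t != c.
Proof.
exists [set c]; split => //; first exact: lebesgue_measure_set1.
by move=> t /= /negP; rewrite negbK => /eqP.
Qed.

Lemma is_derive_translate {R : realType} {V : normedModType R}
    (f : R -> V) (c t : R) (l : V) :
  is_derive (t - c) 1 f l -> is_derive t 1 (fun s => f (s - c)) l.
Proof.
have E : (fun h : R => h^-1 *: (((fun s => f (s - c)) \o shift t) (h *: 1)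
                               - f (t - c)))
       = (fun h => h^-1 *: ((f \o shift (t - c)) (h *: 1) - f (t - c))).
  by apply/funext => h /=; rewrite addrA.
move=> [df fl]; apply: DeriveDef; first by rewrite /derivable E.
by rewrite /derive E.
Qed.

(** * Absolute continuity and junctions *)

Section abs_continuity.
Context {R : realType} {V : normedModType R}.
Implicit Types f g : R -> V.

(** With [d] chosen for the tolerance 1, [f] moves by less than 1 over any time shorter than [d],
    and finitely many steps of length [d / 2] cross the interval. *)
Lemma abs_continuous_bounded (a b : R) f : abs_continuous a b f ->
  exists M, forall t, a <= t <= b -> `|f t| <= M.
Proof.
move=> /(_ 1 ltr01)[d d0 fd].
have step s t : a <= s -> s <= t -> t <= b -> t - s < d ->
    `|f t| <= `|f s| + 1.
  move=> as_ st tb tsd.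
  have := fd 1%N (fun=> s) (fun=> t); rewrite !big_ord1.
  move=> /(_ _ _ tsd)/ltW fts.
  rewrite -lerBlDl; apply: le_trans (lerB_dist _ _) (fts _ _).
  - by move=> i _; rewrite as_ st tb.
  - by move=> i j /andP[ij]; rewrite ltnS leqn0 => /eqP j0; rewrite j0 in ij.
have bound k : forall t, a <= t <= b -> t <= a + k%:R * (d / 2) ->
    `|f t| <= `|f a| + k%:R.
  elim: k => [|k IH] t /andP[at_ tb] tk.
    by rewrite addr0 (_ : t = a) //; apply/le_anti; rewrite at_; lra.
  pose s := Num.max a (t - d / 2).
  have as_ : a <= s by rewrite le_max lexx.
  have ts : t - d / 2 <= s by rewrite le_max lexx orbT.
  have st : s <= t by rewrite ge_max at_; lra.
  apply: le_trans (step s t as_ st tb _) _; first by lra.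
  rewrite -natr1 addrA lerD2r; apply: IH; first by rewrite as_ (le_trans st).
  rewrite ge_max; apply/andP; split.
    by rewrite lerDl mulr_ge0// divr_ge0// ltW.
  by move: tk; rewrite -natr1; lra.
pose k := (Num.truncn ((b - a) / (d / 2))).+1.
exists (`|f a| + k%:R) => t /[dup] tab /andP[_ tb]; apply: bound => //.
rewrite (le_trans tb)// -lerBlDl -ler_pdivrMr ?divr_gt0//.
exact/ltW/truncnS_gt.
Qed.

(* The junction c is attributed to the second function, whose time is shifted
   by T. *)
Definition glue {W : Type} (c T : R) (f g : R -> W) : R -> W :=
  fun t => if t < c then f t else g (t - T).

Lemma glue_lt {W : Type} (c T t : R) (f g : R -> W) :
  t < c -> glue c T f g t = f t.
Proof. by rewrite /glue => ->. Qed.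

Lemma glue_ge {W : Type} (c T t : R) (f g : R -> W) :
  c <= t -> glue c T f g t = g (t - T).
Proof. by rewrite /glue leNgt; case: ifP. Qed.

Lemma abs_continuous_glue (T1 T2 : R) f g : 0 <= T1 -> 0 <= T2 ->
  f T1 = g 0 -> abs_continuous 0 T1 f -> abs_continuous 0 T2 g ->
  abs_continuous 0 (T1 + T2) (glue T1 T1 f g).
Proof.
move=> T10 T20 fg fac gac e e0.
(* Each interval [s i, t i] is cut at T1 into its parts in [0, T1] and in
   [T1, T1 + T2]; the second part is translated to [0, T2]. *)
pose mi t := Num.min t T1; pose ma t := Num.max t T1 - T1.
(* Before [T1] the argument of [g] is frozen at 0 and [g] cancels; from [T1] on, [f] is frozen at
   [f T1 = g 0]. *)
have glueE t : glue T1 T1 f g t = f (mi t) + g (ma t) - g 0.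
  rewrite /glue /mi /ma; case: ltP => // _.
    by rewrite subrr addrK.
  by rewrite fg addrAC subrr add0r.
have e20 : 0 < e / 2 by rewrite divr_gt0.
have [d1 d10 fd] := fac _ e20; have [d2 d20 gd] := gac _ e20.
exists (Num.min d1 d2); first by rewrite lt_min d10.
move=> k s t st ts; rewrite lt_min => /andP[std1 std2].
have split_glue i : `|glue T1 T1 f g (t i) - glue T1 T1 f g (s i)| <=
    `|f (mi (t i)) - f (mi (s i))| + `|g (ma (t i)) - g (ma (s i))|.
  rewrite !glueE; apply: le_trans (ler_normD _ _); rewrite le_eqVlt.
  apply/orP/or_introl/eqP; congr `|_|.
  by rewrite opprB addrA subrK addrACA -opprD.
apply: le_lt_trans (ler_sum _ (fun i _ => split_glue (i : 'I_k))) _.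
rewrite big_split /= (splitr e); apply: ltrD.
- apply: (fd k (mi \o s) (mi \o t)) => [i /st|i j /ts|].
  + move=> /and3P[s0 sti _]; rewrite /mi /= !le_min !ge_min s0 T10 sti !lexx.
    by rewrite !orbT.
  + by rewrite /mi /= => tsij; rewrite le_min !ge_min tsij lexx orbT.
  apply: le_lt_trans std1; apply: ler_sum => i _.
  by have /and3P[_ sti _] := st _ (ltn_ord i); rewrite /mi /=;
    case: (ltP (s i) T1); case: (ltP (t i) T1); lra.
- apply: (gd k (ma \o s) (ma \o t)) => [i /st|i j /ts|].
  + move=> /and3P[s0 sti tT]; rewrite /ma /=.
    by case: (ltP (s i) T1); case: (ltP (t i) T1); lra.
  + by rewrite /ma /= => ?; case: (ltP (s j) T1); case: (ltP (t i) T1); lra.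
  apply: le_lt_trans std2; apply: ler_sum => i _.
  by have /and3P[_ sti _] := st _ (ltn_ord i); rewrite /ma /=;
    case: (ltP (s i) T1); case: (ltP (t i) T1); lra.
Qed.

End abs_continuity.

Lemma restrict_eq {T : Type} {V : pointedType} (W : set T) (f : T -> V) t :
  W t -> (f \_ W) t = f t.
Proof. by move=> Wt; rewrite patchE mem_set. Qed.

(** * Restriction and continuation of solutions *)

Section trajectories.
Context {R : realType} {n m : nat} (S : tds R n m).
Local Notation hist_itv := `[- Dmax S, 0]%classic.
Local Notation U_itv T := `[- lag S, - lag S + T]%classic.
Local Notation D_itv T := `[0, T]%classic.

(** Up to time [T] the equation reads the input only at [t - lag S] and the delay only at [t], both
    within the windows kept. *)
Lemma solution_on_restrict (T : R) xi u D x : solution_on S T xi u D x ->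
  solution_on S T xi (u \_ (U_itv T)) (D \_ (D_itv T)) x.
Proof.
move=> [xxi xac xde]; split=> //; move: xde.
apply: (@filterS _ _ (ae_filter_ringOfSetsType (@lebesgue_measure R))).
move=> t xde t0T.
have tU : U_itv T (t - lag S) by rewrite /= in_itv/=; lra.
have tD : D_itv T t by rewrite /= in_itv.
by rewrite (restrict_eq _ _ _ tU) (restrict_eq _ _ _ tD); exact: xde.
Qed.

(** Serves to apply the triangle inequality to segments not known to lie in the state space. *)
Lemma solution_on_bounded (T M : R) xi u D x : 0 <= T ->
  (forall t, hist_itv t -> `|xi t| <= M) -> solution_on S T xi u D x ->
  exists M', forall t, hist_itv t -> `|segment S x T t| <= M'.
Proof.
move=> T0 xiM [xxi /abs_continuous_bounded[N xN] _].
exists (Num.max M N) => t Wt; rewrite /segment restrict_eq//.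
move: Wt; rewrite /= in_itv/= => /andP[Dt t0].
rewrite le_max; have [Tt0|Tt0] := leP (T + t) 0.
  by rewrite xxi ?xiM//= ?in_itv/=; lra.
by rewrite xN ?orbT//; lra.
Qed.

(** The control switches at [T1 - lag S] because the equation reads it [lag S] later. Before [T1],
    [0 <= D t] keeps the delayed argument within [x]; after it, [b t <= Dmax S] keeps it within the
    history of [y]. *)
Lemma solution_on_glue (T1 T2 : R) xi u D x a b y : 0 <= T1 -> 0 <= T2 ->
  0 <= Dmax S ->
  (forall t, 0 <= t < T1 -> 0 <= D t) ->
  (forall t, 0 <= t <= T2 -> b t <= Dmax S) ->
  solution_on S T1 xi u D x -> solution_on S T2 (segment S x T1) a b y ->
  solution_on S (T1 + T2) xi (glue (T1 - lag S) T1 u a) (glue T1 T1 D b)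
    (glue T1 T1 x y).
Proof.
move=> T10 T20 Dmax0 D0 bD [xxi xac xde] [yxi yac yde].
(* As [y] starts from the last segment of [x], the glued function is the shifted [y] already from
   [T1 - Dmax S] on. *)
have xyE t : T1 - Dmax S <= t -> glue T1 T1 x y t = y (t - T1).
  rewrite /glue => tT; case: ltP => // tT1; rewrite yxi; last by lra.
  by rewrite /segment restrict_eq /= ?in_itv/=; [congr x|]; lra.
have y0 : x T1 = y 0.
  rewrite yxi ?lexx ?oppr_le0 ?Dmax0// /segment restrict_eq ?addr0//=.
  by rewrite in_itv/= lexx andbT oppr_le0.
split.
- move=> t /andP[tD t0]; rewrite /glue.
  case: ltP => tT1; first by rewrite xxi ?tD.
  (* Here [T1 <= t <= 0], so both vanish. *)
  have -> : t - T1 = 0 by lra.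
  have T1E : T1 = 0 by lra.
  by rewrite -y0 xxi ?T1E; [congr xi|]; lra.
- exact: abs_continuous_glue.
(* The instant [T1] is discarded as a null set: the one-sided derivatives may differ there. *)
have {yde} := ae_translate T1 _ yde; have := ae_neq T1; move: xde.
apply: (@filterS3 _ _ (ae_filter_ringOfSetsType (@lebesgue_measure R))).
move=> t xde tT1 yde t0.
have [tT|tT] := ltP t T1.
- apply: (near_eq_is_derive (f := x)).
    by near=> s; rewrite glue_lt//; near: s; exact: lt_nbhsl.
  have Dt : 0 <= D t by apply: D0; lra.
  rewrite (glue_lt T1 _ t)// (glue_lt T1 _ t)// !glue_lt; [|lra|lra].
  by apply: xde; lra.
- have {}tT1 : T1 < t by rewrite lt_neqAle eq_sym tT1.
  apply: (near_eq_is_derive (f := fun s => y (s - T1))).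
    by near=> s; rewrite glue_ge// ltW//; near: s; exact: lt_nbhsr.
  have bt : b (t - T1) <= Dmax S by apply: bD; lra.
  rewrite (glue_ge T1 _ t D)// (glue_ge _ _ (t - lag S)); last by lra.
  rewrite !xyE; [|lra|lra].
  have -> : t - b (t - T1) - T1 = t - T1 - b (t - T1) by rewrite addrAC.
  have -> : t - lag S - T1 = t - T1 - lag S by rewrite addrAC.
  by apply: is_derive_translate; apply: yde; lra.
Unshelve. all: by end_near. Qed.

(** If [T2 < Dmax S] the segment reaches back before the junction, where the history of [y] repeats
    [x]. *)
Lemma segment_glue (T1 T2 : R) a b x y : 0 <= T1 -> 0 <= T2 ->
  solution_on S T2 (segment S x T1) a b y ->
  segment S (glue T1 T1 x y) (T1 + T2) = segment S y T2.
Proof.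
move=> T10 T20 [yxi _ _]; apply/funext => t; rewrite /segment !patchE.
case: ifPn => // /set_mem/=; rewrite in_itv/= /glue => t0.
have T12 : T1 + T2 + t - T1 = T2 + t by lra.
case: ltP => tT1; last by rewrite T12.
rewrite yxi /segment ?restrict_eq/= ?in_itv/= ?addrA//; lra.
Qed.


Lemma D_tau_range (tau : R) b t :
  D_tau S tau b -> 0 <= t <= tau -> Dmin S <= b t <= Dmax S.
Proof.
move=> [D [Drange _] ->] /andP[t0 tT].
by rewrite restrict_eq /= ?in_itv/= ?t0//; exact: Drange.
Qed.

Lemma concatenations_glue {V : normedModType R} (a tau : R) k
    (F : set (R -> V)) u w : 0 < tau -> F w -> concatenations a tau k F u ->
  concatenations a tau k.+1 F (glue (k%:R * tau + a) (k%:R * tau) u w).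
Proof.
move=> tau0 Fw [v vu]; exists (fun i => if (i < k)%N then v i else w) => i.
rewrite ltnS leq_eqVlt => /predU1P[->|ik].
  by rewrite ltnn; split=> // t /andP[at_ _]; rewrite glue_ge ?addrK//; lra.
rewrite ik; have [Fi ui] := vu _ ik; split=> // t tE; rewrite glue_lt ?ui//.
have : i.+1%:R * tau <= k%:R * tau by rewrite ler_pM2r// ler_nat.
by rewrite -natr1; lra.
Qed.

Lemma concatenations_D_tau_range (tau : R) k D t : 0 < tau ->
  concatenations 0 tau k (D_tau S tau) D -> 0 <= t < k%:R * tau ->
  Dmin S <= D t <= Dmax S.
Proof.
move=> tau0 [w wD] /andP[t0 tk].
have /andP[] := Num.Theory.truncn_itv (divr_ge0 t0 (ltW tau0)).
set i := Num.truncn _; rewrite ler_pdivlMr// ltr_pdivrMr// -natr1 => it ti.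
have ik : (i < k)%N.
  by rewrite -(ltr_nat R) -(ltr_pM2r tau0) (le_lt_trans it).
have [Fi Di] := wD _ ik.
have -> : D t = w i (t - i%:R * tau) by rewrite -Di ?subrK//; lra.
by apply: D_tau_range Fi _; lra.
Qed.

(** For [k = 0] nothing is concatenated, so any signals serve; the horizon is the single instant 0,
    a null set for the equation. *)
Lemma reachable_initial UU tau : C0 hist_itv setT (xi0 S) ->
  reachable S UU tau (xi0 S).
Proof.
move=> [xi0E _ _]; exists 0%N, (fun=> 0), (fun=> 0); split.
- by exists (fun=> fun=> 0).
- by exists (fun=> fun=> 0).
exists (xi0 S); last first.
  rewrite mul0r /segment -[LHS]xi0E; congr (_ \_ _).
  by apply/funext => t; rewrite add0r.
rewrite mul0r; split=> //.
  move=> e e0; exists 1 => // k s t st _ _; rewrite big1// => i _.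
  have -> : t i = s i by have := st _ (ltn_ord i); lra.
  by rewrite subrr normr0.
apply: (@filterS _ _ (ae_filter_ringOfSetsType (@lebesgue_measure R))
  _ _ _ (ae_neq 0)).
move=> t /eqP t0 tT; exfalso; apply: t0; lra.
Qed.

Lemma reachable_step UU tau p a b q : 0 < tau -> 0 <= Dmin S -> 0 <= Dmax S ->
  U_tau S UU tau a -> D_tau S tau b -> reachable S UU tau p ->
  state_at S tau p a b q -> reachable S UU tau q.
Proof.
move=> tau0 Dmin0 Dmax0 aU bD [k [u [D [uU DD [x xs ->]]]]] [y ys ->].
have k0 : 0 <= k%:R * tau by rewrite mulr_ge0// ltW.
exists k.+1, (glue (k%:R * tau - lag S) (k%:R * tau) u a).
exists (glue (k%:R * tau) (k%:R * tau) D b); split.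
- exact: concatenations_glue.
- by rewrite -[X in glue X _]addr0; exact: concatenations_glue.
exists (glue (k%:R * tau) (k%:R * tau) x y); rewrite -natr1 mulrDl mul1r.
  apply: solution_on_glue => //; first exact: ltW.
    move=> t /(concatenations_D_tau_range _ _ _ _ tau0 DD)/andP[Dt _].
    exact: le_trans Dt.
  by move=> t /(D_tau_range _ _ _ bD)/andP[].
by rewrite (segment_glue _ _ a b)// ltW.
Qed.

(** Labels are compared on closed windows, whereas delta-IDSS measures full signals on half-open
    ones. Norms decrease with the window, and the comparison functions are monotone. *)
Lemma delta_IDSS_segment (XX : set (R -> 'rV[R]_n)) DD beta gammaU gammaD
    (tau : R) xi1 xi2 u1 u2 D1 D2 x1 x2 (eX eU eD : R) :
  0 < tau -> 0 <= Dmin S -> DD `<=` delay_signals S ->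
  delta_IDSS S XX DD beta gammaU gammaD ->
  XX xi1 -> XX xi2 -> inputs S u1 -> inputs S u2 -> DD D1 -> DD D2 ->
  solution S xi1 u1 D1 x1 -> solution S xi2 u2 D2 x2 ->
  sup_norm hist_itv (xi1 \- xi2) <= eX ->
  ess_norm (U_itv tau) (u1 \_ (U_itv tau) \- u2 \_ (U_itv tau)) <= eU ->
  sup_norm (D_itv tau) (D1 \_ (D_itv tau) \- D2 \_ (D_itv tau)) <= eD ->
  sup_norm hist_itv (segment S x1 tau \- segment S x2 tau) <=
    Num.max (beta eX tau) (gammaU eU + gammaD eD).
Proof.
move=> tau0 Dmin0 DDsig [[_ Kbeta _ _] KU KD _ IDSS] X1 X2 U1 U2 DD1 DD2 s1 s2.
move=> leX leU leD.
apply: le_trans (IDSS _ _ _ _ _ _ _ _ X1 X2 U1 U2 DD1 DD2 s1 s2 _ (ltW tau0)) _.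
have UB u t : inputs S u -> U_itv tau t -> `|u t| <= BU S.
  by move=> [_ uB] /=; rewrite in_itv/= => /andP[/uB].
have DB D t : DD D -> D_itv tau t -> `|D t| <= Dmax S.
  move=> /DDsig[DB _] /=; rewrite in_itv/= => /andP[/DB/andP[D0 DM] _].
  by rewrite ger0_norm// (le_trans Dmin0).
have le_max2 (a b c d : R) : a <= c -> b <= d -> Num.max a b <= Num.max c d.
  by move=> ac bd; rewrite ge_max !le_max ac bd orbT.
apply: le_max2.
  exact: le_class_K (Kbeta _ (ltW tau0)) (sup_norm_ge0 _ _) leX.
apply: lerD.
- apply: le_class_K KU (ess_norm_ge0 _ _) (le_trans _ leU).
  have Uitv t : `[- lag S, tau - lag S[%classic t -> U_itv tau t.
    by rewrite /= !in_itv/=; lra.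
  apply: (le_ess_norm _ _ _ _ (BU S + BU S)) => //.
    by move=> t /set_mem/Uitv tU; rewrite /= !restrict_eq.
  by apply: norm_sub_le => t tU; rewrite restrict_eq//; exact: UB.
- apply: le_class_K KD (sup_norm_ge0 _ _) (le_trans _ leD).
  apply: sup_norm_le; first by exists 0; rewrite /= in_itv/= lexx.
  move=> t; rewrite /= in_itv/= => tT.
  have tD : D_itv tau t by rewrite /= in_itv/=; lra.
  have -> : D1 t - D2 t = (D1 \_ (D_itv tau) \- D2 \_ (D_itv tau)) t.
    by rewrite /= !restrict_eq.
  apply: (norm_le_sup_norm _ _ (Dmax S + Dmax S)) => //.
  by apply: norm_sub_le => s sD; rewrite restrict_eq//; exact: DB.
Qed.

End trajectories.

(** * The alternating bisimulation *)

Theorem theorem5p2 (R : realType) (n m : nat) (S : tds R n m)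
  (betaISS : R -> R -> R) (gammaISS : R -> R)
  (hA0 : A0 S) (hA1 : ISS S betaISS gammaISS)
  (bX : R) (hbX : bX = BX S betaISS gammaISS)
  (eps : R) (heps : 0 < eps)
  (* inputs of the digital controller *)
  (UU : set (R -> 'rV[R]_m)) (hUU : UU `<=` inputs S)
  (* time-delay functions for which the system is delta-IDSS *)
  (DD : set (R -> R)) (hDD : delays S `<=` DD)
  (hDDsig : DD `<=` delay_signals S)
  (beta : R -> R -> R) (gammaU gammaD : R -> R)
  (hIDSS : delta_IDSS S (state_space S bX) DD beta gammaU gammaD)
  (tau : R) (htau : 0 < tau) (hbeta : beta eps tau < eps)
  (* reachable states remain in the state space *)
  (hreach : reachable S UU tau `<=` state_space S bX)
  (AX : R -> set (R -> 'rV[R]_n))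
  (hAX : countable_approximation `[- Dmax S, 0]%classic (X_values bX)
           (R_tau S UU tau bX) AX)
  (AD : R -> set (R -> R))
  (hAD : countable_approximation `[0, tau]%classic (delay_values S)
           (D_tau S tau) AD)
  (lambdaX lambdaU lambdaD : R)
  (hlX : 0 < lambdaX) (hlU : 0 < lambdaU) (hlD : 0 < lambdaD)
  (hADDD : AD lambdaD `<=` restrictions `[0, tau]%classic DD)
  (hAU : approximates (ess_norm `[- lag S, - lag S + tau]%classic) lambdaU
           (U_tau S UU tau) (A_U S UU tau lambdaU))
  (hlambda : Num.max (beta eps tau) (gammaU lambdaU + gammaD lambdaD)
             + Num.max (beta lambdaX tau) (gammaD lambdaD) + lambdaX <= eps)
  (A1 : set (R -> 'rV[R]_m)) (B1 : set (R -> R))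
  (hlabels : T_tau_labels S UU tau bX A1 B1)
  (q20 : R -> 'rV[R]_n) (hq20 : AX lambdaX q20)
  (hq20xi : sup_norm `[- Dmax S, 0]%classic (xi0 S \- q20) <= lambdaX) :
  AeA_bisimilar eps
    (T_approx S UU tau bX beta gammaD AX AD lambdaX lambdaU lambdaD q20)
    (T_tau S tau bX A1 B1).
Proof.
move: (hA0) => [_ _ [_ Dmin0 Dmax0 _] _ [xi0C _ _]].
move: (hIDSS) => [[_ Kbeta _ _] KU KD exsol _].
have [hAXC [_ AXcover AXnear]] := hAX _ hlX.
have [_ [_ ADcover ADnear]] := hAD _ hlD.
have [_ AUcover _] := hAU.
have hist0 : `[- Dmax S, 0]%classic !=set0.
  by exists 0; rewrite /= in_itv/= lexx oppr_le0 Dmax0.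
have XM q : state_space S bX q ->
    forall t, `[- Dmax S, 0]%classic t -> `|q t| <= bX.
  by move=> [_ _ qX] t /qX.
have stateP q u D x : solution S q u D x -> state_at S tau q
    (u \_ `[- lag S, - lag S + tau]%classic) (D \_ `[0, tau]%classic)
    (segment S x tau).
  move=> xs; exists x => //; apply: solution_on_restrict.
  exact: xs (ltW htau).
(* Solutions exist for all labels, so the definedness conditions in the mutual equations for [A1]
   and [B1] always hold, and these sets are all of [U_tau] and [D_tau]. *)
have labels x a b : state_space S bX x -> U_tau S UU tau a -> D_tau S tau b ->
    exists p, state_at S tau x a b p.
  move=> xX [u /hUU uU ->] [D /hDD DDD ->].
  have [y ys] := exsol _ _ _ xX uU DDD.
  by exists (segment S y tau); exact: stateP.
move: hlabels => [A1E B1E].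
have A1U : A1 = U_tau S UU tau.
  rewrite A1E; apply/seteqP; split=> [a []//|a aU]; split=> // x b xX.
  by rewrite B1E => -[bD _]; exact: labels.
have B1D : B1 = D_tau S tau.
  rewrite B1E; apply/seteqP; split=> [b []//|b bD]; split=> // x a xX.
  by rewrite A1U => aU; exact: labels.
clear A1E B1E; subst A1 B1.
(* States of T_tau outside the reachable set must be excluded: their successors
   may leave the state space. *)
pose Rel q2 q1 := [/\ AX lambdaX q2, R_tau S UU tau bX q1 &
  sup_norm `[- Dmax S, 0]%classic (q1 \- q2) <= eps].
(* This serves both simulations, which differ only in which labels are given and which are chosen in
   reply. *)
have step q2 q1 a1 a2 b1 b2 : Rel q2 q1 -> U_tau S UU tau a1 ->
    A_U S UU tau lambdaU a2 -> D_tau S tau b1 -> AD lambdaD b2 ->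
    ess_norm `[- lag S, - lag S + tau]%classic (a1 \- a2) <= lambdaU ->
    sup_norm `[0, tau]%classic (b1 \- b2) <= lambdaD ->
    exists p1 p2, [/\
      transition (T_tau S tau bX (U_tau S UU tau) (D_tau S tau)) q1 a1 b1 p1,
      transition (T_approx S UU tau bX beta gammaD AX AD lambdaX lambdaU
                    lambdaD q20) q2 a2 b2 p2
      & Rel p2 p1].
  move=> [q2A [q1X q1r] q12] a1U a2A b1D b2A a12 b12.
  have q2X := hAXC _ q2A; have a2U := a2A.1.
  have [y [yX yr] yq2] := AXnear _ q2A.
  have [u1 /hUU u1U a1E] := a1U; have [u2 /hUU u2U a2E] := a2U.
  have [D1 /hDD D1D b1E] := b1D; have [D2 D2D b2E] := hADDD _ b2A.
  have [x1 x1s] := exsol _ _ _ q1X u1U D1D.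
  have [z zs] := exsol _ _ _ q2X u2U D2D.
  have [w ws] := exsol _ _ _ yX u2U D1D.
  have x1at := stateP _ _ _ _ x1s; rewrite -a1E -b1E in x1at.
  have zat := stateP _ _ _ _ zs; rewrite -a2E -b2E in zat.
  have wat := stateP _ _ _ _ ws; rewrite -a2E -b1E in wat.
  have p1r := reachable_step _ _ _ _ _ _ _ htau Dmin0 Dmax0 a1U b1D q1r x1at.
  have wr := reachable_step _ _ _ _ _ _ _ htau Dmin0 Dmax0 a2U b1D yr wat.
  have p1X := hreach _ p1r; have wX := hreach _ wr.
  have [p2 p2A wp2] := AXcover _ (conj wX wr).
  have p2X := hAXC _ p2A.
  have [Mz zM] := solution_on_bounded _ _ _ _ _ _ _ (ltW htau) (XM _ q2X)
    (zs _ (ltW htau)).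
  have p1z : sup_norm `[- Dmax S, 0]%classic
      (segment S x1 tau \- segment S z tau) <=
      Num.max (beta eps tau) (gammaU lambdaU + gammaD lambdaD).
    apply: (delta_IDSS_segment _ _ _ _ _ _ _ _ _ _ _ _ _ _ _ _ _ _ htau Dmin0
      hDDsig hIDSS q1X q2X u1U u2U D1D D2D x1s zs q12).
      by rewrite -a1E -a2E.
    by rewrite -b1E -b2E.
  have wz : sup_norm `[- Dmax S, 0]%classic
      (segment S w tau \- segment S z tau) <=
      Num.max (beta lambdaX tau) (gammaD lambdaD).
    (* [y] and [q2] receive the same control, so the input term is [gammaU 0]. *)
    have -> : gammaD lambdaD = gammaU 0 + gammaD lambdaD.
      by have [_ _ ->] := KU; rewrite add0r.
    apply: (delta_IDSS_segment _ _ _ _ _ _ _ _ _ _ _ _ _ _ _ _ _ _ htau Dmin0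
      hDDsig hIDSS yX q2X u2U u2U D1D D2D ws zs yq2).
      by rewrite ess_norm_subrr.
    by rewrite -b1E -b2E.
  have p2z : sup_norm `[- Dmax S, 0]%classic (p2 \- segment S z tau) <=
      Num.max (beta lambdaX tau) (gammaD lambdaD) + lambdaX.
    apply: le_trans
      (sup_norm_trans _ _ _ _ _ _ _ hist0 (XM _ p2X) (XM _ wX) zM) _.
    by rewrite addrC sup_norm_subC lerD// sup_norm_subC.
  exists (segment S x1 tau), p2; split.
  - by [].
  - by split=> //; exists (segment S z tau).
  - split=> //.
    apply: le_trans
      (sup_norm_trans _ _ _ _ _ _ _ hist0 (XM _ p1X) zM (XM _ p2X)) _.
    apply: le_trans hlambda; rewrite -addrA; apply: lerD => //.
    by rewrite sup_norm_subC.
have xi0r := reachable_initial S UU tau xi0C.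
(* Both maxima in [hlambda] are nonnegative; the bound makes the initial states related. *)
have lXeps : lambdaX <= eps.
  have gU0 := class_K_ge0 _ _ KU (ltW hlU).
  have gD0 := class_K_ge0 _ _ KD (ltW hlD).
  apply: le_trans hlambda; rewrite lerDr addr_ge0// le_max ?gD0 ?orbT//.
  by rewrite addr_ge0 ?orbT.
exists Rel; split.
- split=> //; last exact: le_trans hq20xi lXeps.
  by split=> //; exact: hreach.
- split=> //= [q2 q1 [? [? _] _]//|q2 q1 q12]; split.
    by have [_ _] := q12; rewrite sup_norm_subC.
  (* A control in [A_U] is itself in [U_tau], so it is its own reply, at distance 0. *)
  move=> a2 a2A; exists a2; first exact: a2A.1.
  move=> b1 b1D; have [b2 b2A b12] := ADcover _ b1D.
  exists b2 => //.
  have [|p1 [p2 [? ? ?]]] := step _ _ a2 a2 _ _ q12 a2A.1 a2A b1D b2A _ b12.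
    by rewrite ess_norm_subrr ltW.
  by exists p2, p1; split.
- split=> //= [q1 q2 [? [? _] _]//|q1 q2 q12]; split; first by have [] := q12.
  move=> a1 a1U; have [a2 a2A a12] := AUcover _ a1U.
  exists a2 => // b2 b2A; have [b1 b1D b12] := ADnear _ b2A.
  exists b1 => //; exact: step q12 a1U a2A b1D b2A a12 b12.
Qed.
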